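(* Let $p$ be an odd prime, $m,s$ positive integers, $R=\mathbb F_{p^m}+u\mathbb F_{p^m}$ with $u^2=0$, and let $\sigma$ be a ring automorphism of $R$. Let $\alpha,\beta$ be nonzero elements of $\mathbb F_{p^m}$ and let $\alpha_0\in\mathbb F_{p^m}$ be the element with $\alpha_0^{p^s}=\alpha^{-1}$. Let $C=\langle(\alpha_0x-1)^i\rangle\subseteq\mathcal R_{\alpha,\beta}$ be an $(\alpha+u\beta)$-constacyclic code of length $p^s$ over $R$, where $0\le i\le2p^s$. Then $C$ is $\sigma$-self-orthogonal if and only if $p^s\le i\le 2p^s$.
   Context: $\mathcal R_{\alpha,\beta}=R[x]/\langle x^{p^s}-(\alpha+u\beta)\rangle$. For a unit $\lambda$ of $R$, a $\lambda$-constacyclic code of length $n$ is an $R$-submodule of $R^n$ stable under $(x_0,\dots,x_{n-1})\mapsto(\lambda x_{n-1},x_0,\dots,x_{n-2})$; it is identified with an ideal of $R[x]/\langle x^n-\lambda\rangle$ via $(c_0,\dots,c_{n-1})\mapsto c_0+c_1x+\cdots+c_{n-1}x^{n-1}$. The $\sigma$-dual of $C\subseteq R^n$ is $C^{\perp_\sigma}=\{\mathbf x\in R^n:\sum_{i=0}^{n-1}c_i\sigma(x_i)=0\text{ for all }\mathbf c\in C\}$; $C$ is $\sigma$-self-orthogonal if $C\subseteq C^{\perp_\sigma}$ as subsets of $R^n$. *)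

(* Defs.v *)
From HB Require Import structures.
From mathcomp Require Import all_boot all_algebra.

Set Implicit Arguments.
Unset Strict Implicit.
Unset Printing Implicit Defensive.

Import GRing.Theory.
Local Open Scope ring_scope.

(* Over a finite base ring, the quotient rings {poly %/ h} are declared finite
   so that the joins finComNzRingType and finComUnitRingType are inferred. *)
HB.instance Definition _ (A : finComNzRingType) (h : {poly A}) :=
  Finite.on {poly %/ h}.
HB.instance Definition _ (F : finFieldType) (h : {poly F}) :=
  Finite.on {poly %/ h}.

(* F + u F with u ^ 2 = 0, realized as F[u] / <u ^ 2>; the class of u is 'qX,
   and a in F is embedded as a%:A. *)
Notation dual_numbers F := {poly %/ ('X^2 : {poly F})}.

Definition dual_u (F : finFieldType) : dual_numbers F := 'qX.

(* R[x] / <x ^ n - lambda>: for 0 < n the polynomial is monic of size n.+1, so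
   the library quotient is indeed by this polynomial. *)
Definition constacyclic_poly (R : comNzRingType) (n : nat) (lambda : R) :
  {poly R} := 'X^n - lambda%:P.

Notation constacyclic_ring n lambda := {poly %/ constacyclic_poly n lambda}.

(* (c_0, ..., c_(n-1)) |-> (lambda c_(n-1), c_0, ..., c_(n-2)); ord_pred is the
   cyclic predecessor. *)
Definition constacyclic_shift (R : comNzRingType) (n : nat) (lambda : R)
    (c : 'rV[R]_n) : 'rV[R]_n :=
  \row_j (if j == 0 :> nat then lambda * c 0 (ord_pred j)
          else c 0 (ord_pred j)).

Definition constacyclic_code (R : finComUnitRingType) (n : nat) (lambda : R)
    (C : {set 'rV[R]_n}) : Prop :=
  [/\ lambda \is a GRing.unit, submod_closed C
    & forall c, c \in C -> constacyclic_shift lambda c \in C].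

(* c |-> c_0 + c_1 x + ... + c_(n-1) x ^ (n-1) *)
Definition codeword_class (R : comNzRingType) (n : nat) (lambda : R)
    (c : 'rV[R]_n) : constacyclic_ring n lambda := in_qpoly _ (rVpoly c).

Definition code_ideal (R : finComNzRingType) (n : nat) (lambda : R)
    (C : {set 'rV[R]_n}) : {set constacyclic_ring n lambda} :=
  [set codeword_class lambda c | c in C].

Definition principal_ideal (A : finComNzRingType) (a : A) : {set A} :=
  [set b * a | b : A].

Definition sigma_dual (R : finComNzRingType) (n : nat) (sigma : R -> R)
    (C : {set 'rV[R]_n}) : {set 'rV[R]_n} :=
  [set x : 'rV[R]_n |
     [forall c in C, \sum_(i < n) c 0 i * sigma (x 0 i) == 0]].

Definition sigma_self_orthogonal (R : finComNzRingType) (n : nat)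
    (sigma : R -> R) (C : {set 'rV[R]_n}) : bool :=
  C \subset sigma_dual sigma C.

(* The identification of constacyclic codes with ideals, in the direction that
   shows that every principal ideal is the ideal of a constacyclic code. *)
Section IdealCode.
Context (R : finComUnitRingType) (n : nat) (n_gt0 : (0 < n)%N) (lambda : R).

Lemma mk_monic_constacyclic_poly :
  mk_monic (constacyclic_poly n lambda) = constacyclic_poly n lambda.
Proof.
by rewrite /mk_monic size_XnsubC // monicXnsubC // ltnS n_gt0.
Qed.

Lemma codeword_class_val (c : 'rV[R]_n) :
  codeword_class lambda c = rVpoly c :> {poly R}.
Proof.
rewrite /codeword_class in_qpoly_small // mk_monic_constacyclic_poly.
by rewrite size_XnsubC // ltnS size_poly.
Qed.

Lemma codeword_class_surj (f : constacyclic_ring n lambda) :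
  exists c, codeword_class lambda c = f.
Proof.
exists (poly_rV f); apply: val_inj.
rewrite [LHS]codeword_class_val poly_rV_K //.
have /leq_trans := size_npoly f; apply.
by rewrite mk_monic_constacyclic_poly size_XnsubC.
Qed.

Lemma codeword_class_shift (c : 'rV[R]_n) :
  codeword_class lambda (constacyclic_shift lambda c) =
  'qX * codeword_class lambda c.
Proof.
case: n n_gt0 c => // k _ c; rewrite /codeword_class.
have -> : rVpoly (constacyclic_shift lambda c) =
    'X * rVpoly c - c 0 ord_max *: constacyclic_poly k.+1 lambda.
  apply/polyP=> j; rewrite coefB coefZ coefXM coefB coefXn coefC.
  have [j_lt|j_ge] := ltnP j k.+1.
    rewrite (coef_rVpoly_ord _ (Ordinal j_lt)) mxE /=.
    case: j j_lt => [|j] j_lt /=.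
      rewrite !sub0r mulrN opprK mulrC; congr (c 0 _ * _).
      by apply: val_inj; rewrite /= modn_small.
    rewrite (ltn_eqF j_lt) subr0 mulr0 subr0.
    have j_lt' : (j < k.+1)%N by apply: ltnW.
    rewrite (coef_rVpoly_ord c (Ordinal j_lt')); congr (c 0 _); apply: val_inj => /=.
    by rewrite modnDr modn_small.
  rewrite coef_rVpoly; case: insubP => [i|_]; first by rewrite ltnNge j_ge.
  case: j j_ge => // j; rewrite ltnS /= eqSS subr0 => j_ge.
  have [->|j_neq] := eqVneq j k.
    by rewrite (coef_rVpoly_ord c ord_max) mulr1 subrr.
  rewrite mulr0 subr0 coef_rVpoly; case: insubP => // i ik _.
  by move: ik; rewrite ltnS leqNgt ltn_neqAle eq_sym j_neq j_ge.
rewrite raddfB /= linearZ /= rmorphM /=.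
suff -> : in_qpoly (constacyclic_poly k.+1 lambda)
  (constacyclic_poly k.+1 lambda) = 0 by rewrite scaler0 subr0.
apply: val_inj => /=; rewrite /mk_monic size_XnsubC // monicXnsubC //=.
by rewrite Pdiv.RingMonic.rmodpp // monicXnsubC.
Qed.

Lemma constacyclic_code_of_ideal (a : constacyclic_ring n lambda)
    (C := [set c : 'rV[R]_n | codeword_class lambda c \in principal_ideal a]) :
  lambda \is a GRing.unit ->
  constacyclic_code lambda C /\ code_ideal lambda C = principal_ideal a.
Proof.
move=> lambda_unit; split; first split=> //.
- split=> [|b x y].
    rewrite !inE; apply/imsetP; exists 0 => //.
    by rewrite mul0r /codeword_class !raddf0.
  rewrite !inE => /imsetP[f _ fE] /imsetP[g _ gE].
  apply/imsetP; exists (b *: f + g) => //.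
  by rewrite mulrDl -scalerAl -fE -gE /codeword_class !linearP.
- move=> c; rewrite !inE => /imsetP[f _ fE]; apply/imsetP.
  by exists ('qX * f) => //; rewrite codeword_class_shift fE mulrA.
- apply/setP=> f; apply/imsetP/idP=> [[c cC ->]|fa]; first by rewrite inE in cC.
  by have [c cE] := codeword_class_surj f; exists c; rewrite // inE cE.
Qed.

End IdealCode.

Lemma dual_numbers_unit (F : finFieldType) (alpha beta : F) :
  alpha != 0 -> alpha%:A + beta *: dual_u F \is a GRing.unit.
Proof.
move=> alpha_neq0.
have uu : dual_u F * dual_u F = 0.
  rewrite /dual_u -in_qpolyM -expr2; apply: val_inj => /=.
  by rewrite mk_monic_Xn Pdiv.RingMonic.rmodpp // monicXn.
apply/unitrPr; exists (alpha^-1%:A - (beta / alpha ^+ 2) *: dual_u F).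
rewrite mulrDl !mulrBr -!scalerAl -!scalerAr !mul1r !mulr1 uu !scaler0 subr0.
rewrite !scalerA mulfV // scale1r -addrA -scaleNr -scalerDl.
suff -> : - (alpha * (beta / alpha ^+ 2)) + beta / alpha = 0.
  by rewrite scale0r addr0.
by rewrite expr2 invfM mulrCA (mulrA alpha) mulfV // mul1r addNr.
Qed.

(* Main.v *)
(* Put y = alpha0 x - 1 and n = p ^ s. In characteristic p,
   y ^ n = alpha^-1 x ^ n - 1 = (beta / alpha) u.
   If n <= i, every codeword is thus a multiple of u; as sigma u is nilpotent,
   u * sigma u = 0 and C is self-orthogonal.
   If i < n, then y ^ i is a codeword with constant coefficient (-1) ^ i, while
   u, a multiple of y ^ n, is the codeword (u, 0, ..., 0); they pair to
   (-1) ^ i * sigma u != 0. *)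
Require Import Defs.
From mathcomp Require Import all_boot all_algebra.
From mathcomp Require Import finfield.
Set Implicit Arguments.
Unset Strict Implicit.
Unset Printing Implicit Defensive.
Import GRing.Theory.
Local Open Scope ring_scope.

Section DualNumbers.
Context (F : finFieldType).
Implicit Type z : dual_numbers F.
Local Notation u := (dual_u F).

Lemma dual_u_sq : u * u = 0.
Proof.
rewrite /dual_u -in_qpolyM -expr2; apply: val_inj => /=.
by rewrite mk_monic_Xn Pdiv.RingMonic.rmodpp // monicXn.
Qed.

Lemma dual_u_val : u = 'X :> {poly F}.
Proof. by rewrite /dual_u qpolyXE ?size_polyXn ?monicXn. Qed.

Lemma dual_u_neq0 : u != 0.
Proof.
apply/eqP => /(congr1 (fun z : dual_numbers F => z : {poly F}))/eqP.
by rewrite dual_u_val polyX_eq0.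
Qed.

(** A residue modulo ['X^2] has the form b + c u with b, c in [F], and multiplying by u kills c
    u. *)
Lemma mul_dual_u z : exists a : F, u * z = a *: u.
Proof.
pose P : {poly F} := z.
have sP : (size P <= 2)%N.
  by apply: leq_trans (size_npoly z) _; rewrite mk_monic_Xn size_polyXn.
have -> : z = P`_0 *: 1 + P`_1 *: u.
  apply: val_inj; change (P = P`_0 *: 1 + P`_1 *: (u : {poly F})).
  rewrite dual_u_val.
  apply/polyP => j; rewrite coefD !coefZ coef1 coefX.
  case: j => [|[|j]]; rewrite ?mulr1 ?mulr0 ?addr0 ?add0r //.
  by rewrite nth_default // (leq_trans sP).
by exists P`_0; rewrite mulrDr -!scalerAr dual_u_sq scaler0 addr0 mulr1.
Qed.

(** Writing u z = a u with a in [F] gives a^2 u = u z^2 = 0, so a = 0. Applied to z = sigma u, this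
    avoids any classification of the automorphisms sigma. *)
Lemma dual_u_mul_nilpotent z : z * z = 0 -> u * z = 0.
Proof.
move=> zz; have [a uz] := mul_dual_u z.
have /eqP : a *: (a *: u) = 0 by rewrite -uz scalerAl -uz -mulrA zz mulr0.
by rewrite scalerA scaler_eq0 (negPf dual_u_neq0) orbF mulf_eq0 orbb uz
  => /eqP ->; rewrite scale0r.
Qed.

End DualNumbers.

Section ConstacyclicRing.
Context (R : finComUnitRingType) (n : nat) (n_gt0 : (0 < n)%N) (lambda : R).
Implicit Types (c : 'rV[R]_n) (C : {set 'rV[R]_n}).

Lemma constacyclic_qX_exp : 'qX ^+ n = lambda%:A :> constacyclic_ring n lambda.
Proof.
apply/eqP; rewrite -subr_eq0 -rmorphXn.
have -> : lambda%:A = in_qpoly (constacyclic_poly n lambda) lambda%:P.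
  by rewrite -alg_polyC in_qpolyZ rmorph1.
rewrite -rmorphB -/(constacyclic_poly n lambda); apply/eqP/val_inj => /=.
rewrite mk_monic_constacyclic_poly //.
by rewrite Pdiv.RingMonic.rmodpp // monicXnsubC.
Qed.

Lemma codeword_class_inj : injective (@codeword_class R n lambda).
Proof.
move=> c d cd; apply: (can_inj rVpolyK).
by rewrite -!(codeword_class_val n_gt0 lambda) cd.
Qed.

Lemma codeword_class_poly_rV (P : {poly R}) :
  (size P <= n)%N ->
    codeword_class lambda (poly_rV P : 'rV_n) = in_qpoly _ P.
Proof. by move=> sP; rewrite /codeword_class poly_rV_K. Qed.

Lemma mem_codeword_class c C :
  (codeword_class lambda c \in code_ideal lambda C) = (c \in C).
Proof. exact: mem_imset codeword_class_inj. Qed.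

(** The quotient inherits characteristic p from [R], so raising to the power n = p ^ k is additive;
    then x ^ n = lambda turns the result into a scalar. *)
Lemma constacyclic_frobenius p (a : R) k :
  n = (p ^ k)%N -> p \in [pchar R] ->
  (a *: 'qX - 1) ^+ n = (a ^+ n * lambda - 1)%:A
    :> constacyclic_ring n lambda.
Proof.
move=> nE pR; have nA : [pchar (constacyclic_ring n lambda)].-nat n.
  rewrite (eq_pnat _ (pchar_qpoly _)) (eq_pnat _ (pcharf_eq pR)) nE.
  by rewrite pnatX pnat_id // (pcharf_prime pR).
rewrite exprDn_pchar // exprNn_pchar // expr1n exprZn constacyclic_qX_exp.
by rewrite scalerA scalerBl scale1r.
Qed.

End ConstacyclicRing.

Theorem theorem4p1 (p m s : nat) (F : finFieldType)
    (p_prime : prime p) (p_odd : odd p) (m_gt0 : (0 < m)%N) (s_gt0 : (0 < s)%N)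
    (cardF : #|F| = (p ^ m)%N)
    (sigma : {rmorphism dual_numbers F -> dual_numbers F})
    (sigma_bij : bijective sigma)
    (alpha beta alpha0 : F) (alpha_neq0 : alpha != 0) (beta_neq0 : beta != 0)
    (alpha0E : alpha0 ^+ (p ^ s) = alpha^-1)
    (lambda : dual_numbers F) (lambdaE : lambda = alpha%:A + beta *: dual_u F)
    (i : nat) (i_le : (i <= 2 * p ^ s)%N)
    (C : {set 'rV[dual_numbers F]_(p ^ s)})
    (C_code : constacyclic_code lambda C)
    (C_ideal : code_ideal lambda C =
       principal_ideal ((((alpha0%:A : dual_numbers F) *: 'qX - 1)
         : constacyclic_ring (p ^ s) lambda) ^+ i)) :
  sigma_self_orthogonal sigma C <-> (p ^ s <= i <= 2 * p ^ s)%N.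
Proof.
rewrite i_le andbT; set n := (p ^ s)%N in C C_code C_ideal i_le alpha0E *.
have n_gt0 : (0 < n)%N by rewrite expn_gt0 prime_gt0.
set a : dual_numbers F := alpha0%:A in C_ideal.
set y := a *: 'qX - 1 in C_ideal.
pose u := dual_u F; pose g := beta / alpha.
have g_neq0 : g != 0 by rewrite mulf_neq0 ?invr_eq0.
have yn : y ^+ n = (g *: u)%:A.
  have pR : p \in [pchar (dual_numbers F)].
    by rewrite pchar_qpoly (card_finPcharP cardF).
  rewrite (constacyclic_frobenius n_gt0 lambda a (erefl n) pR); congr (_%:A).
  rewrite exprZn expr1n alpha0E lambdaE mulrDr -!scalerAl !mul1r !scalerA.
  by rewrite mulVf // scale1r mulrC addrAC subrr add0r.
have memC c :
    (c \in C) = (codeword_class lambda c \in principal_ideal (y ^+ i)).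
  by rewrite -C_ideal mem_codeword_class.
split=> [/subsetP selfC | n_le_i].
- rewrite leqNgt; apply/negP => i_lt.
  (* Since i < n, this polynomial has degree below n, so its coefficients are directly the entries
     of the codeword of y ^ i. *)
  pose P : {poly dual_numbers F} := (a *: 'X - 1) ^+ i.
  have sP : (size P <= n)%N.
    apply: leq_trans i_lt; rewrite (leq_trans (size_poly_exp_leq _ _)) //.
    rewrite ltnS -[leqRHS]mul1n leq_mul2r; apply/orP; right.
    rewrite -subn1 leq_subLR (leq_trans (size_polyD _ _)) // geq_max size_polyN.
    by rewrite size_poly1 (leq_trans (size_scale_leq _ _)) ?size_polyX.
  have Py : in_qpoly (constacyclic_poly n lambda) P = y ^+ i.
    by rewrite rmorphXn rmorphB rmorph1 /= in_qpolyZ.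
  have cC : poly_rV P \in C.
    rewrite memC codeword_class_poly_rV // Py.
    by apply/imsetP; exists 1 => //; rewrite mul1r.
  have dC : poly_rV u%:P \in C.
    rewrite memC codeword_class_poly_rV; last first.
      by rewrite (leq_trans (size_polyC_leq1 _)).
    (* Here u = g^-1 y ^ n = (g^-1 y ^ (n - i)) y ^ i. The scalar g^-1 is embedded twice, from [F]
       into the dual numbers and from there into the quotient ring. *)
    apply/imsetP; exists ((g^-1%:A)%:A * y ^+ (n - i)) => //.
    rewrite -mulrA -exprD subnK 1?ltnW // yn -alg_polyC in_qpolyZ rmorph1 /=.
    by rewrite -scalerAl mul1r scalerA -scalerAl mul1r scalerA mulVf // scale1r.
  have /[!inE]/forall_inP/(_ _ cC)/eqP := selfC _ dC.
  have sum_at0 (f : 'I_n -> dual_numbers F) :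
      (forall j : 'I_n, j != 0 :> nat -> f j = 0) ->
      \sum_j f j = f (Ordinal n_gt0).
    by move=> f0; rewrite (bigD1 (Ordinal n_gt0)) //= big1 ?addr0.
  (* The codeword (u, 0, ..., 0) is the argument of sigma, and sigma 0 = 0, so only index 0
     contributes. *)
  rewrite sum_at0 => [|j j_neq0]; last first.
    by rewrite !mxE coefC (negPf j_neq0) rmorph0 mulr0.
  have su_neq0 : sigma u != 0.
    by rewrite raddf_eq0 ?dual_u_neq0 //; apply: bij_inj.
  (* The constant coefficient of [P] is its value at 0, namely (-1) ^ i. *)
  rewrite !mxE coefC /= -horner_coef0 horner_exp !hornerE => /eqP.
  by rewrite -signr_odd mulr_sign; case: ifP => _;
    rewrite ?oppr_eq0 (negPf su_neq0).
- have multC c : c \in C -> exists d, c = u *: d.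
    rewrite memC => /imsetP[f _]; rewrite -(subnK n_le_i) exprD yn mulrA.
    (* As f y ^ i = u (g f y ^ (i - n)), take for d the row representing the second factor;
       injectivity of [codeword_class] carries the equality back to rows. *)
    have [d dE] := codeword_class_surj n_gt0 (g%:A *: (f * y ^+ (i - n))).
    move=> cE; exists d; apply: (codeword_class_inj n_gt0 (lambda := lambda)).
    transitivity (u *: codeword_class lambda d); last first.
      by rewrite /codeword_class !linearZ.
    by rewrite cE dE -scalerAr mulr1 scalerA -scalerAr mulr1.
  have uu : u * sigma u = 0.
    by apply: dual_u_mul_nilpotent; rewrite -rmorphM dual_u_sq rmorph0.
  apply/subsetP => _ /multC[d ->]; rewrite inE.
  apply/forall_inP => _ /multC[e ->]; apply/eqP.
  (* Each term regroups as (u e_j) sigma(u d_j) = (u sigma u) (e_j sigma d_j) = 0. *)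
  by rewrite big1 // => j _; rewrite !mxE rmorphM mulrACA uu mul0r.
Qed.
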